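(* Let $I\subset\mathbb R$ be an open interval, let $q$ be real analytic on $I$ with $q'>0$, and let $g$ be real analytic on $q(I)$. Let $a,b$ be real constants, and consider on $I$ the equation $$a+b\,q-g(q)=0.$$ If $g''$ has one strict sign on $q(I)$, then this equation has at most two zeros in $I$, counted with multiplicity. The conclusion is uniform for a family of such equations whenever the monotonicity and curvature margins are uniform.
   Context: The zeros are those of the function $x\mapsto a+b\,q(x)-g(q(x))$ on $I$; the multiplicity of a zero is its order of vanishing. ''One strict sign'' means $g''>0$ on all of $q(I)$ or $g''<0$ on all of $q(I)$. For a family, uniform margins means that the lower bounds for $q'$ and $|g''|$ are uniform over the family. *)

(* Defs.v *)
From Stdlib Require Import Reals List.
From Coquelicot Require Import Coquelicot.
Open Scope R_scope.

(** The open interval with finite or infinite endpoints [lo] and [hi]. *)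
Definition Rbar_interval (lo hi : Rbar) (x : R) : Prop :=
  Rbar_lt lo x /\ Rbar_lt x hi.

Definition image_of (f : R -> R) (D : R -> Prop) (y : R) : Prop :=
  exists x, D x /\ y = f x.

Definition analytic_at (f : R -> R) (x0 : R) : Prop :=
  exists (c : nat -> R) (r : R), 0 < r /\
    forall x, Rabs (x - x0) < r -> is_pseries c (x - x0) (f x).

(** Meant for open [D]: the values of [f] away from [D] are then irrelevant. *)
Definition analytic_on (f : R -> R) (D : R -> Prop) : Prop :=
  forall x, D x -> analytic_at f x.

Definition one_strict_sign (h : R -> R) (D : R -> Prop) : Prop :=
  (forall y, D y -> 0 < h y) \/ (forall y, D y -> h y < 0).

(** Meant for [f] smooth near [x], where the total [Derive_n] is the genuine
    iterated derivative. *)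
Definition order_of_vanishing (f : R -> R) (x : R) (m : nat) : Prop :=
  (forall k, (k < m)%nat -> Derive_n f k x = 0) /\ Derive_n f m x <> 0.

(** The list [l] enumerates the zeros of [f] in [D], each paired with its
    multiplicity; in particular there are finitely many zeros, all of finite
    order. *)
Definition at_most_zeros_with_mult (f : R -> R) (D : R -> Prop) (N : nat)
    : Prop :=
  exists l : list (R * nat),
    NoDup (map fst l) /\
    (forall x, In x (map fst l) <-> D x /\ f x = 0) /\
    (forall x m, In (x, m) l -> order_of_vanishing f x m) /\
    (list_sum (map snd l) <= N)%nat.

(* Main.v *)
(** Write [f = a + b q - g o q]. Then [f' = u q'] with [u = b - g' o q], and
    [u' = - (g'' o q) q'] never vanishes, so [u] is injective on the interval by
    Rolle's theorem. Rolle's theorem applied to [f] puts a zero of [u] strictly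
    between any two zeros of [f]; hence [f] has at most two zeros, and when it has
    two, [u] vanishes at neither of them, so both are simple. At a zero of [f]
    that is also a zero of [u], [f'' = u' q'] is nonzero, so the order is two. *)
Require Import Defs.
From Stdlib Require Import Reals List Lra Lia Classical.
From Coquelicot Require Import Coquelicot.
Open Scope R_scope.

(** * Derivatives of analytic functions *)

(** Outside the radius of convergence the terms of the series do not tend to zero, which contradicts
    convergence. Turns pointwise convergence on a disk into the radius bound that termwise
    differentiation requires. *)
Lemma CV_radius_ge (c : nat -> R) (r : R) :
  (forall z, Rabs z < r -> ex_pseries c z) ->
  forall z, Rabs z < r -> Rbar_lt (Rabs z) (CV_radius c).
Proof.
  intros Hc z Hz.
  (* Convergence at a point only bounds the radius below weakly; the midpoint [w] between [Rabs z]
     and [r] makes the bound at [z] strict. *)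
  assert (Hw : Rabs z < (Rabs z + r) / 2 < r) by lra.
  set (w := (Rabs z + r) / 2) in Hw.
  pose proof (Rabs_pos z) as Hz0.
  assert (Hwa : Rabs w = w) by (apply Rabs_right; lra).
  apply Rbar_lt_le_trans with (Rabs w); [simpl; lra|].
  apply Rbar_not_lt_le; intros Hlt.
  apply (CV_disk_outside c w Hlt), ex_series_lim_0.
  assert (Hex : ex_pseries c w) by (apply Hc; lra).
  apply ex_series_ext with (2 := Hex).
  intros n; rewrite pow_n_pow; apply Rmult_comm.
Qed.

(** Termwise differentiation: the differentiated series represents the derivative on the same disk.
    The second conjunct lets the lemma be iterated to reach second derivatives. *)
Lemma analytic_at_is_derive (f : R -> R) (x0 : R) :
  analytic_at f x0 -> is_derive f x0 (Derive f x0) /\ analytic_at (Derive f) x0.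
Proof.
  intros (c & r & Hr & Hf).
  assert (Hcv : forall z, Rabs z < r -> Rbar_lt (Rabs z) (CV_radius c)).
  { apply CV_radius_ge; intros z Hz.
    exists (f (z + x0)).
    assert (Hz' : z + x0 - x0 = z) by ring.
    specialize (Hf (z + x0)); rewrite Hz' in Hf; exact (Hf Hz). }
  assert (Hd : forall x, Rabs (x - x0) < r ->
            is_derive f x (PSeries (PS_derive c) (x - x0))).
  { intros x Hx.
    apply is_derive_ext_loc with (fun y => PSeries c (y - x0)).
    - assert (He : 0 < r - Rabs (x - x0)) by lra.
      exists (mkposreal _ He); intros y Hy.
      apply is_pseries_unique, Hf.
      change (Rabs (y - x) < r - Rabs (x - x0)) in Hy.
      replace (y - x0) with ((y - x) + (x - x0)) by ring.
      pose proof (Rabs_triang (y - x) (x - x0)); lra.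
    - evar_last.
      + apply (is_derive_comp (PSeries c) (fun y => y - x0)).
        * now apply is_derive_PSeries, Hcv.
        * auto_derive; [easy|reflexivity].
      + unfold scal; simpl; unfold mult; simpl; ring. }
  split.
  - apply Derive_correct; eexists; apply Hd.
    now rewrite Rminus_diag, Rabs_R0.
  - exists (PS_derive c), r; split; [exact Hr|]; intros x Hx.
    rewrite (is_derive_unique _ _ _ (Hd x Hx)).
    now apply PSeries_correct, ex_pseries_derive, Hcv.
Qed.

(** * Rolle's theorem and open intervals *)

Lemma rolle_is_derive (f df : R -> R) (x y : R) :
  x < y -> (forall z, x <= z <= y -> is_derive f z (df z)) -> f x = f y ->
  exists z, x < z < y /\ df z = 0.
Proof.
  intros Hxy Hd He.
  destruct (MVT_cor2 f df x y Hxy) as (z & Hz & Hin).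
  - intros z Hz; now apply is_derive_Reals, Hd.
  - exists z; split; [exact Hin|].
    assert (Hm : df z * (y - x) = 0) by lra.
    apply Rmult_integral in Hm; lra.
Qed.

Lemma Rbar_interval_convex (lo hi : Rbar) (x y z : R) :
  Rbar_interval lo hi x -> Rbar_interval lo hi y -> x <= z <= y ->
  Rbar_interval lo hi z.
Proof.
  intros [Hx _] [_ Hy] Hz; split.
  - apply Rbar_lt_le_trans with x; [easy|simpl; lra].
  - apply Rbar_le_lt_trans with y; [simpl; lra|easy].
Qed.

Lemma Rbar_interval_locally (lo hi : Rbar) (x : R) :
  Rbar_interval lo hi x -> locally x (Rbar_interval lo hi).
Proof.
  intros [Hlo Hhi]; apply filter_and.
  - now apply (open_Rbar_gt lo).
  - now apply (open_Rbar_lt hi).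
Qed.

(** * Zeros of a function whose derivative factors as [u * p] *)

Section Factored_derivative.

Variables (lo hi : Rbar) (f u p du dp : R -> R).
Let D := Rbar_interval lo hi.
Hypothesis f_deriv : forall x, D x -> is_derive f x (u x * p x).
Hypothesis u_deriv : forall x, D x -> is_derive u x (du x).
Hypothesis p_deriv : forall x, D x -> is_derive p x (dp x).
Hypothesis p_neq0 : forall x, D x -> p x <> 0.
Hypothesis du_neq0 : forall x, D x -> du x <> 0.

Lemma factor_neq_of_lt (x y : R) : D x -> D y -> x < y -> u x <> u y.
Proof.
  intros Hx Hy Hxy He.
  assert (Hin : forall z, x <= z <= y -> D z)
    by (intros z; now apply Rbar_interval_convex).
  destruct (rolle_is_derive u du x y Hxy) as (z & Hz & Hz0); auto.
  apply (du_neq0 z); [apply Hin; lra|exact Hz0].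
Qed.

Lemma factor_zero_between (x y : R) :
  D x -> D y -> f x = 0 -> f y = 0 -> x < y ->
  exists z, x < z < y /\ D z /\ u z = 0.
Proof.
  intros Hx Hy Hfx Hfy Hxy.
  assert (Hin : forall z, x <= z <= y -> D z)
    by (intros z; now apply Rbar_interval_convex).
  destruct (rolle_is_derive f (fun z => u z * p z) x y Hxy) as (z & Hz & Hz0);
    [auto|lra|].
  assert (Dz : D z) by (apply Hin; lra).
  exists z; split; [exact Hz|split; [exact Dz|]].
  apply Rmult_integral in Hz0; destruct Hz0 as [|Hp]; [easy|].
  now elim (p_neq0 z Dz).
Qed.

(** [u] already vanishes strictly between the two zeros of [f], and it is injective. This is what
    makes two distinct zeros simple. *)
Lemma factor_neq0_of_two_zeros (x y : R) :
  D x -> D y -> f x = 0 -> f y = 0 -> x < y -> u x <> 0 /\ u y <> 0.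
Proof.
  intros Hx Hy Hfx Hfy Hxy.
  destruct (factor_zero_between x y) as (z & Hz & Dz & Hu); auto.
  pose proof (factor_neq_of_lt x z Hx Dz (proj1 Hz)).
  pose proof (factor_neq_of_lt z y Dz Hy (proj2 Hz)).
  split; congruence.
Qed.

(** Each of the two gaps would contain a zero of the injective function [u]. *)
Lemma no_three_zeros (x y z : R) :
  D x -> D y -> D z -> f x = 0 -> f y = 0 -> f z = 0 -> x < y -> y < z -> False.
Proof.
  intros Hx Hy Hz Hfx Hfy Hfz Hxy Hyz.
  destruct (factor_zero_between x y) as (v & Hv & Dv & Hu); auto.
  destruct (factor_zero_between y z) as (w & Hw & Dw & Hu'); auto.
  apply (factor_neq_of_lt v w); auto; lra.
Qed.

Lemma order_one (x : R) :
  D x -> f x = 0 -> u x <> 0 -> order_of_vanishing f x 1.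
Proof.
  intros Dx Hf Hu; split.
  - intros k Hk; replace k with 0%nat by lia; simpl; exact Hf.
  - change (Derive f x <> 0).
    rewrite (is_derive_unique _ _ _ (f_deriv x Dx)).
    apply Rmult_integral_contrapositive_currified; auto.
Qed.

Lemma order_two (x : R) :
  D x -> f x = 0 -> u x = 0 -> order_of_vanishing f x 2.
Proof.
  intros Dx Hf Hu; split.
  - intros k Hk.
    assert (Hk' : k = 0%nat \/ k = 1%nat) by lia.
    destruct Hk' as [-> | ->]; [exact Hf|].
    change (Derive f x = 0).
    rewrite (is_derive_unique _ _ _ (f_deriv x Dx)), Hu; ring.
  - change (Derive (Derive f) x <> 0).
    assert (Hd : is_derive (Derive f) x (du x * p x)).
    (* Differentiating [Derive f] needs its formula on a neighbourhood of [x], which the open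
       interval provides. In the product rule the term [u x * dp x] then drops out. *)
    { apply is_derive_ext_loc with (fun y => u y * p y).
      - apply (filter_imp D); [|now apply Rbar_interval_locally].
        intros y Dy; symmetry; now apply is_derive_unique, f_deriv.
      - evar_last.
        + apply (is_derive_mult u p); [now apply u_deriv|now apply p_deriv|].
          intros; apply Rmult_comm.
        + unfold plus, mult; simpl; rewrite Hu; ring. }
    rewrite (is_derive_unique _ _ _ Hd).
    apply Rmult_integral_contrapositive_currified; auto.
Qed.

Lemma at_most_two_zeros : at_most_zeros_with_mult f D 2.
Proof.
  (* Excluded middle separates no zero, a single zero and at least two zeros; each case supplies an
     explicit list. *)
  destruct (classic (exists x, D x /\ f x = 0)) as [(x & Dx & Hx)|Hnone].
  2: { exists nil; split; [constructor|split; [|split; [easy|simpl; lia]]].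
       intros x; split; [easy|intros Hx; apply Hnone; now exists x]. }
  destruct (classic (exists y, D y /\ f y = 0 /\ y <> x)) as [(y & Dy & Hy & Hyx)|Huniq].
  - assert (Hu : u x <> 0 /\ u y <> 0).
    { destruct (Rlt_or_le x y) as [Hlt|Hle].
      - now apply factor_neq0_of_two_zeros.
      - apply and_comm, factor_neq0_of_two_zeros; auto; lra. }
    exists ((x, 1%nat) :: (y, 1%nat) :: nil).
    split; [|split; [|split]].
    + repeat constructor; simpl; intuition.
    + intros z; simpl; split; [intros [<-|[<-|[]]]; now split|].
      intros [Dz Hz].
      destruct (Req_dec z x) as [|Hzx]; [now left|].
      destruct (Req_dec z y) as [|Hzy]; [now right; left|].
      exfalso.
      (* Of the eight sign patterns two are cyclic and contradictory; the other six are the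
         orderings of three distinct zeros. *)
      destruct (Rdichotomy _ _ Hyx), (Rdichotomy _ _ Hzx), (Rdichotomy _ _ Hzy);
        try lra;
        [ apply (no_three_zeros z y x) | apply (no_three_zeros y z x)
        | apply (no_three_zeros y x z) | apply (no_three_zeros z x y)
        | apply (no_three_zeros x z y) | apply (no_three_zeros x y z) ]; auto.
    + intros z m [[= <- <-]|[[= <- <-]|[]]]; now apply order_one.
    + simpl; lia.
  (* A lone zero may be double, so its order depends on whether [u] vanishes there. *)
  - assert (Hm : exists m, (m <= 2)%nat /\ order_of_vanishing f x m).
    { destruct (Req_dec (u x) 0).
      - exists 2%nat; split; [lia|now apply order_two].
      - exists 1%nat; split; [lia|now apply order_one]. }
    destruct Hm as (m & Hm & Ho).
    exists ((x, m) :: nil).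
    split; [|split; [|split]].
    + repeat constructor; simpl; tauto.
    + intros z; simpl; split.
      * intros [<-|[]]; now split.
      * intros [Dz Hz]; left; apply NNPP; intros Hn.
        apply Huniq; exists z; auto.
    + intros z k [[= <- <-]|[]]; exact Ho.
    + simpl; lia.
Qed.

End Factored_derivative.

(** * The equation in q and g *)

(** Common core of both halves of the theorem: strict signs and positive margins alike yield the
    nonvanishing of q' and g'' assumed here. *)
Lemma at_most_two_zeros_comp (lo hi : Rbar) (q g : R -> R) (a b : R) :
  analytic_on q (Rbar_interval lo hi) ->
  (forall x, Rbar_interval lo hi x -> Derive q x <> 0) ->
  analytic_on g (image_of q (Rbar_interval lo hi)) ->
  (forall y, image_of q (Rbar_interval lo hi) y -> Derive_n g 2 y <> 0) ->
  at_most_zeros_with_mult (fun x => a + b * q x - g (q x))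
    (Rbar_interval lo hi) 2.
Proof.
  intros Hq Hq' Hg Hg''.
  assert (Him : forall x, Rbar_interval lo hi x ->
            image_of q (Rbar_interval lo hi) (q x)) by (intros x Hx; now exists x).
  assert (Dq : forall x, Rbar_interval lo hi x -> is_derive q x (Derive q x))
    by (intros x Hx; now apply analytic_at_is_derive, Hq).
  assert (Dg : forall x, Rbar_interval lo hi x ->
            is_derive g (q x) (Derive g (q x)))
    by (intros x Hx; now apply analytic_at_is_derive, Hg, Him).
  apply at_most_two_zeros with
    (u := fun x => b - Derive g (q x)) (p := Derive q)
    (du := fun x => - (Derive_n g 2 (q x) * Derive q x))
    (dp := Derive_n q 2).
  - intros x Hx.
    auto_derive; [repeat split|].
    + eexists; now apply Dq.
    + eexists; now apply Dg.
    + eexists; now apply Dq.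
    + change (Derive (fun y => q y) x) with (Derive q x).
      change (Derive (fun y => g y) (q x)) with (Derive g (q x)); ring.
  - intros x Hx.
    evar_last.
    + apply (is_derive_minus (fun _ => b) (fun y => Derive g (q y))).
      * apply is_derive_const.
      * apply (is_derive_comp (Derive g) q); [|now apply Dq].
        (* Used twice: [Derive g] is analytic at [q x], hence differentiable there. *)
        now apply analytic_at_is_derive, analytic_at_is_derive, Hg, Him.
    + change (0 + - (Derive q x * Derive_n g 2 (q x))
              = - (Derive_n g 2 (q x) * Derive q x)); ring.
  - intros x Hx.
    now apply analytic_at_is_derive, analytic_at_is_derive, Hq.
  - exact Hq'.
  - intros x Hx; apply Ropp_neq_0_compat.
    apply Rmult_integral_contrapositive_currified; auto.
Qed.

Theorem lemma27 :
  (forall (lo hi : Rbar) (q g : R -> R) (a b : R),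
     analytic_on q (Rbar_interval lo hi) ->
     (forall x, Rbar_interval lo hi x -> 0 < Derive q x) ->
     analytic_on g (image_of q (Rbar_interval lo hi)) ->
     one_strict_sign (Derive_n g 2) (image_of q (Rbar_interval lo hi)) ->
     at_most_zeros_with_mult (fun x => a + b * q x - g (q x))
       (Rbar_interval lo hi) 2)
  /\
  (forall (T : Type) (lo hi : T -> Rbar) (q g : T -> R -> R) (a b : T -> R),
     (forall t, analytic_on (q t) (Rbar_interval (lo t) (hi t))) ->
     (forall t, analytic_on (g t) (image_of (q t) (Rbar_interval (lo t) (hi t)))) ->
     (exists mu : R, 0 < mu /\
        forall t x, Rbar_interval (lo t) (hi t) x -> mu <= Derive (q t) x) ->
     (exists kappa : R, 0 < kappa /\
        forall t y, image_of (q t) (Rbar_interval (lo t) (hi t)) y ->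
          kappa <= Rabs (Derive_n (g t) 2 y)) ->
     forall t,
       at_most_zeros_with_mult (fun x => a t + b t * q t x - g t (q t x))
         (Rbar_interval (lo t) (hi t)) 2).
Proof.
  split.
  - intros lo hi q g a b Hq Hq' Hg Hsign.
    apply at_most_two_zeros_comp; auto.
    + intros x Hx; now apply Rgt_not_eq, Hq'.
    + intros y Hy; destruct Hsign as [Hs|Hs]; specialize (Hs y Hy); lra.
  (* The margins [mu] and [kappa] keep q' and g'' away from zero for every [t], so the same bound 2
     serves the whole family. *)
  - intros T lo hi q g a b Hq Hg (mu & Hmu & Hq') (kappa & Hkappa & Hg'') t.
    apply at_most_two_zeros_comp; auto.
    + intros x Hx; specialize (Hq' t x Hx); lra.
    + intros y Hy He; specialize (Hg'' t y Hy).
      rewrite He, Rabs_R0 in Hg''; lra.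
Qed.
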